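(* Let $P$ be a path and let $X\subseteq P$ be a finite set of $n+1\geq 2$ events which are the events of a finite chain $(q_0,q_1,\dots,q_n)$, so $X=\{q_0,\dots,q_n\}$. Write $a=q_0$, $b=q_n$. Let $P_1=\operatorname{prolongation}(b,a)$, $P_2=\operatorname{prolongation}(a,b)$, and $$S=\{\operatorname{segment}(q_i,q_{i+1}) : 0\le i<n\}.$$ Then $P=\bigl(\bigcup S\bigr)\cup P_1\cup P_2\cup X$; every element of $S$ is a segment; any two distinct members of $S\cup\{P_1,P_2\}$ are disjoint sets; and $P_1\neq P_2$, $P_1\notin S$, $P_2\notin S$.
   Context: Let $\mathcal E$ be a set, whose elements are called events; let $\mathcal P$ be a set of subsets of $\mathcal E$, whose elements are called paths; and let $[\,\cdot\;\cdot\;\cdot\,]$ be a ternary relation (betweenness) on $\mathcal E$. Definitions. For distinct events $a,b$ lying on a common path $ab$ (unique by (I3) below): $\operatorname{segment}(a,b)=\{x\in ab:[a\;x\;b]\}$ and $\operatorname{prolongation}(a,b)=\{x\in ab:[a\;b\;x]\}$ (the prolongation beyond $b$). A segment is a set of the form $\operatorname{segment}(a,b)$. A finite chain is a sequence $(q_0,\dots,q_n)$ of events, $n\ge1$, such that: if $n=1$, then $q_0\ne q_1$ and some path contains both; if $n\ge2$, then $[q_i\;q_j\;q_k]$ for all $0\le i<j<k\le n$. An infinite chain is a sequence $(q_i)_{i\in\mathbb N}$ of events with $[q_i\;q_j\;q_k]$ for all $i<j<k$. A bound of an infinite chain is an event $q$ with $[q_i\;q_j\;q]$ for all $i<j$;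 a closest bound is a bound $q$ such that $[q_0\;q\;q']$ for every bound $q'\ne q$. For a path $Q$ and an event $b\notin Q$, the unreachable subset of $Q$ from $b$ is $Q(b,\emptyset)=\{x\in Q:\text{ no path contains both } b \text{ and } x\}$. For distinct paths $Q,R$ meeting at $x$ and $Q_a\in Q$, $Q(Q_a,R,x,\emptyset)=\{y: [x\;y\;Q_a]\text{ and there is } w\in R \text{ (}w\notin Q\text{) with } Q_a,y\in Q(w,\emptyset)\}$. $\mathrm{SPRAY}[x]$ is the set of paths containing the event $x$. Three distinct paths of $\mathrm{SPRAY}[x]$ are dependent if some path not in $\mathrm{SPRAY}[x]$ meets each of the three; then each is said to be dependent on the set of the other two. Inductively, a path $T$ is dependent on a set $S\subseteq\mathrm{SPRAY}[x]$ with $n\ge3$ elements if $T$ is dependent on a set of two paths $\{S_1,S_2\}$, each of which is dependent on some subset of $S$ with $n-1$ elements. A set of paths is dependent if it contains a path $P$ and a subset not containing $P$ on which $P$ is dependent (for some $x$); it is independent if it has no dependent subset. $\mathrm{SPRAY}[x]$ is a 3-SPRAY if it contains four distinct paths forming an independent set such that every path of $\mathrm{SPRAY}[x]$ is dependent on the set of these four. The following axioms are assumed. (I1) $\mathcal E\neq\emptyset$. (I2) For distinct events $a,b$ there are paths $R\ni a$, $S\ni b$ with $R\cap S\ne\emptyset$. (I3) For any two distinct events there is at most one path containing both. (I4) If $\mathcal E\ne\emptyset$, there is at least one 3-SPRAY. (O1) If $[a\;b\;c]$ then some path contains $a,b,c$. (O2) $[a\;b\;c]\Rightarrow[c\;b\;a]$.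 (O3) $[a\;b\;c]\Rightarrow a\neq c$. (O4) $[a\;b\;c]$ and $[b\;c\;d]$ imply $[a\;b\;d]$ (no distinctness of $a,d$ is assumed). (O5) If $a,b,c$ are distinct events of one path, then $[a\;b\;c]$ or $[b\;c\;a]$ or $[c\;a\;b]$. (O6) If $Q,R,S$ are distinct paths, $T$ is a path, $a\in Q\cap R$, $b\in Q\cap S$, $c\in R\cap S$, and there are $d\in S$ with $[b\;c\;d]$ and $e\in R$ with $[c\;e\;a]$ and $d,e\in T$, then there is $f\in T\cap Q$ belonging to a finite chain with first event $a$ and last event $b$, where $a,f,b$ are distinct. (I5) For any path $Q$ and event $b\notin Q$, the set $Q(b,\emptyset)$ contains at least two events. (I6) For any path $Q$, event $b\notin Q$ and distinct $Q_x,Q_z\in Q(b,\emptyset)$ there is a finite chain $(q_0,\dots,q_n)$ with $q_0=Q_x$, $q_n=Q_z$ such that for all $i\in\{1,\dots,n\}$: $q_i\in Q(b,\emptyset)$, and every event $y$ with $[q_{i-1}\;y\;q_i]$ lies in $Q(b,\emptyset)$. (I7) For any path $Q$, event $b\notin Q$, $Q_x\in Q\setminus Q(b,\emptyset)$ and $Q_y\in Q(b,\emptyset)$ there is a finite chain $(q_0,\dots,q_n)$ and $0<m<n$ with $q_0=Q_x$, $q_m=Q_y$ and $q_n\in Q\setminus Q(b,\emptyset)$. (S) If $Q,R,S$ are distinct paths with $x\in Q\cap R\cap S$, and $Q_a\in Q\setminus\{x\}$ satisfies $Q(Q_a,R,x,\emptyset)=Q(Q_a,S,x,\emptyset)$,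 then there is a map $\theta:\mathcal E\to\mathcal E$ such that $P\mapsto\theta(P)$ (direct image) is a bijection $\mathcal P\to\mathcal P$, $\theta(y)=y$ for all $y\in Q$, and $\theta(R)=S$. (C) Every infinite chain that has a bound has a closest bound. *)

(* Defs.v *)
From mathcomp Require Import all_boot.
From mathcomp Require Import all_classical.

Set Implicit Arguments.
Unset Strict Implicit.
Unset Printing Implicit Defensive.

Local Open Scope classical_set_scope.
Local Open Scope card_scope.

Section Spacetime.

(* The set of events is the type [E]; [betw a b c] is the relation [a b c]. *)
Variables (E : Type) (paths : set (set E)) (betw : E -> E -> E -> Prop).

(* [Q] is "the" path ab through the distinct events [a] and [b]; it is unique
   by [ax_I3] below. *)
Definition joins (Q : set E) (a b : E) : Prop :=
  [/\ paths Q, a <> b, Q a & Q b].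

(* Total in [a], [b]; empty unless [a], [b] are distinct and on a common path. *)
Definition segment (a b : E) : set E :=
  [set x | exists2 Q, joins Q a b & Q x /\ betw a x b].

Definition prolongation (a b : E) : set E :=
  [set x | exists2 Q, joins Q a b & Q x /\ betw a b x].

Definition is_segment (A : set E) : Prop :=
  exists a b, (exists Q, joins Q a b) /\ A = segment a b.

(* The finite sequence (q 0, ..., q n); values of [q] beyond [n] are ignored. *)
Definition finite_chain (n : nat) (q : nat -> E) : Prop :=
  [/\ (1 <= n)%N,
      n = 1%N -> exists Q, joins Q (q 0%N) (q 1%N)
    & (2 <= n)%N -> forall i j k : nat, (i < j)%N -> (j < k)%N -> (k <= n)%N ->
        betw (q i) (q j) (q k)].

Definition infinite_chain (q : nat -> E) : Prop :=
  forall i j k : nat, (i < j)%N -> (j < k)%N -> betw (q i) (q j) (q k).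

Definition chain_bound (q : nat -> E) (e : E) : Prop :=
  forall i j : nat, (i < j)%N -> betw (q i) (q j) e.

Definition closest_bound (q : nat -> E) (e : E) : Prop :=
  chain_bound q e /\
  forall e', chain_bound q e' -> e' <> e -> betw (q 0%N) e e'.

(* Q(b, 0), used for a path [Q] and an event [b] outside [Q]. *)
Definition unreachable (Q : set E) (b : E) : set E :=
  [set x | Q x /\ ~ exists R, [/\ paths R, R b & R x]].

(* Q(Qa, R, x, 0), used for distinct paths [Q], [R] meeting at [x], and [Qa]
   in [Q]. *)
Definition unreachable_via (Q : set E) (Qa : E) (R : set E) (x : E) : set E :=
  [set y | betw x y Qa /\
     exists w, [/\ R w, ~ Q w, unreachable Q w Qa & unreachable Q w y]].

Definition spray (x : E) : set (set E) := [set Q | paths Q /\ Q x].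

Definition dependent3 (x : E) (Q R S : set E) : Prop :=
  [/\ spray x Q /\ spray x R /\ spray x S,
      Q <> R /\ Q <> S /\ R <> S
    & exists T, [/\ paths T, ~ spray x T,
        T `&` Q !=set0, T `&` R !=set0 & T `&` S !=set0]].

Inductive dependent_on (x : E) : set E -> set (set E) -> Prop :=
| dependent_on_two T S1 S2 :
    dependent3 x T S1 S2 -> dependent_on x T [set S1; S2]
| dependent_on_more n T S S1 S2 A1 A2 :
    (3 <= n)%N -> S `<=` spray x -> S #= `I_n ->
    A1 `<=` S -> A1 #= `I_n.-1 -> dependent_on x S1 A1 ->
    A2 `<=` S -> A2 #= `I_n.-1 -> dependent_on x S2 A2 ->
    dependent_on x T [set S1; S2] ->
    dependent_on x T S.

Definition dependent_set (A : set (set E)) : Prop :=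
  exists P S, [/\ A P, S `<=` A, ~ S P & exists x, dependent_on x P S].

Definition independent_set (A : set (set E)) : Prop :=
  forall B, B `<=` A -> ~ dependent_set B.

Definition three_spray (x : E) : Prop :=
  exists S1 S2 S3 S4 : set E,
    let A := [set S1; S2; S3; S4] in
    [/\ A `<=` spray x,
        [/\ S1 <> S2, S1 <> S3 & S1 <> S4] /\
        [/\ S2 <> S3, S2 <> S4 & S3 <> S4],
        independent_set A
      & forall T, spray x T -> dependent_on x T A].

Record minkowski_axioms : Prop := MinkowskiAxioms {
  ax_I1 : [set: E] !=set0;
  ax_I2 : forall a b, a <> b ->
    exists R S, [/\ paths R, paths S, R a, S b & R `&` S !=set0];
  ax_I3 : forall a b Q R, a <> b ->
    paths Q -> Q a -> Q b -> paths R -> R a -> R b -> Q = R;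
  ax_I4 : [set: E] !=set0 -> exists x, three_spray x;
  ax_O1 : forall a b c, betw a b c -> exists Q, [/\ paths Q, Q a, Q b & Q c];
  ax_O2 : forall a b c, betw a b c -> betw c b a;
  ax_O3 : forall a b c, betw a b c -> a <> c;
  ax_O4 : forall a b c d, betw a b c -> betw b c d -> betw a b d;
  ax_O5 : forall Q a b c, paths Q -> Q a -> Q b -> Q c ->
    a <> b -> a <> c -> b <> c ->
    [\/ betw a b c, betw b c a | betw c a b];
  ax_O6 : forall Q R S T a b c,
    paths Q -> paths R -> paths S -> paths T ->
    Q <> R -> Q <> S -> R <> S ->
    (Q `&` R) a -> (Q `&` S) b -> (R `&` S) c ->
    (exists d e, [/\ S d /\ betw b c d, R e /\ betw c e a, T d & T e]) ->
    exists f, [/\ (T `&` Q) f,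
      a <> f /\ a <> b /\ f <> b
    & exists n q, [/\ finite_chain n q, q 0%N = a, q n = b
        & exists2 i, (i <= n)%N & q i = f]];
  ax_I5 : forall Q b, paths Q -> ~ Q b ->
    exists y z, [/\ y <> z, unreachable Q b y & unreachable Q b z];
  ax_I6 : forall Q b Qx Qz, paths Q -> ~ Q b ->
    unreachable Q b Qx -> unreachable Q b Qz -> Qx <> Qz ->
    exists n q, [/\ finite_chain n q, q 0%N = Qx, q n = Qz
    & forall i, (1 <= i <= n)%N ->
        unreachable Q b (q i) /\
        forall y, betw (q i.-1) y (q i) -> unreachable Q b y];
  ax_I7 : forall Q b Qx Qy, paths Q -> ~ Q b ->
    (Q `\` unreachable Q b) Qx -> unreachable Q b Qy ->
    exists n m q, [/\ finite_chain n q, (0 < m < n)%N,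
      q 0%N = Qx, q m = Qy & (Q `\` unreachable Q b) (q n)];
  ax_S : forall Q R S x Qa, paths Q -> paths R -> paths S ->
    Q <> R -> Q <> S -> R <> S ->
    (Q `&` R `&` S) x -> (Q `\` [set x]) Qa ->
    unreachable_via Q Qa R x = unreachable_via Q Qa S x ->
    exists theta : E -> E,
      [/\ set_bij paths paths (fun P : set E => theta @` P),
          forall y, Q y -> theta y = y
        & theta @` R = S];
  ax_C : forall q, infinite_chain q ->
    (exists e, chain_bound q e) -> exists e, closest_bound q e
}.

End Spacetime.

(* Main.v *)
(** Only the linear order of each path needs work: O4 alone leaves one
    non-linear order on four events of a path, the star [a b c], [a b d], [c b d].
    Stars are excluded by a Pasch argument, where the unreachable sets being
    bounded (I7) supplies the auxiliary paths that the axioms do not grant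
    outright.  The events of a chain then cut the path as on a line; I5 and I7
    make the two prolongations nonempty, hence distinct from each other and from
    the segments. *)

Require Import Defs.
From mathcomp Require Import all_boot.
From mathcomp Require Import all_classical.

Local Open Scope classical_set_scope.
Local Open Scope card_scope.

Section PathOrder.
Context {E : Type} {paths : set (set E)} {betw : E -> E -> E -> Prop}.
Context (HM : minkowski_axioms paths betw).

(** * Elementary betweenness, and O6 as a Pasch property *)

Lemma betw_sym {a b c} : betw a b c -> betw c b a.
Proof. exact: (ax_O2 HM). Qed.

Lemma betw_neq13 {a b c} : betw a b c -> a <> c.
Proof. exact: (ax_O3 HM). Qed.

(** If [a = b], O4 applied to [c a a] and [a a c] gives [c a c], against O3; this relies on O4 not
    asking its outer events to be distinct. *)
Lemma betw_neq12 {a b c} : betw a b c -> a <> b.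
Proof.
move=> h eab; subst b.
exact: (betw_neq13 (ax_O4 HM (betw_sym h) h)).
Qed.

Lemma betw_neq23 {a b c} : betw a b c -> b <> c.
Proof. by move=> /betw_sym h e; apply: (betw_neq12 h). Qed.

Lemma betw_not_rot {a b c} : betw a b c -> ~ betw b c a.
Proof. by move=> h1 h2; apply: (betw_neq13 (ax_O4 HM h1 h2)). Qed.

Lemma betw_not_swap {a b c} : betw a b c -> ~ betw b a c.
Proof. by move=> /betw_sym h1 /betw_sym h2; apply: (betw_not_rot h2 (betw_sym h1)). Qed.

Lemma path_meet {Q R x y} :
  paths Q -> paths R -> Q <> R -> Q x -> R x -> Q y -> R y -> x = y.
Proof.
move=> pQ pR nQR Qx Rx Qy Ry; case: (pselect (x = y)) => // nxy.
by case: nQR; apply: (ax_I3 HM nxy).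
Qed.

(** Turns the conclusion of O6, membership in a chain from [a] to [b], into betweenness: an event
    distinct from both ends has an index strictly between 0 and [n]. *)
Lemma chain_betw {n q i} : finite_chain paths betw n q -> (i <= n)%N ->
  q 0%N <> q i -> q i <> q n -> betw (q 0%N) (q i) (q n).
Proof.
move=> [_ _ ch] lin n0 nn.
have i0 : (0 < i)%N by case: i n0 {lin nn}.
have iltn : (i < n)%N.
  by rewrite ltn_neqAle lin andbT; apply/eqP => e; apply: nn; rewrite e.
by apply: ch => //; apply: leq_ltn_trans iltn.
Qed.

Lemma pasch {Q R S T a b c d e} :
  paths Q -> paths R -> paths S -> paths T ->
  Q <> R -> Q <> S -> R <> S ->
  Q a -> R a -> Q b -> S b -> R c -> S c ->
  betw b c d -> betw c e a -> S d -> R e -> T d -> T e ->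
  exists f, [/\ T f, Q f & betw a f b].
Proof.
move=> pQ pR pS pT QR QS RS Qa Ra Qb Sb Rc Sc bcd cea Sd Re Td Te.
have [//|f [[Tf Qf] [af [_ fb]] [n [q [ch q0 qn [i lin qi]]]]]] :=
  ax_O6 HM pQ pR pS pT QR QS RS (conj Qa Ra) (conj Qb Sb) (conj Rc Sc).
  by exists d, e.
by exists f; split=> //; rewrite -q0 -qi -qn; apply: chain_betw; rewrite ?q0 ?qn ?qi.
Qed.

(** * Existence of events and paths, and reachability *)

(** Suppose [Q] contained every event. By I3 a path through the vertex [x] of a 3-SPRAY would be [Q]
    or the singleton of [x], which leaves no room for three distinct paths. *)
Lemma event_off_path {Q} : paths Q -> exists c, ~ Q c.
Proof.
move=> pQ; apply: contrapT => nc.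
have allQ c : Q c by apply: contrapT => h; apply: nc; exists c.
have [x [S1 [S2 [S3 [S4 [sub [[n12 n13 _] [n23 _ _]] _ _]]]]]] := ax_I4 HM (ax_I1 HM).
have QorX S : paths S -> S x -> S = Q \/ S = [set x].
  move=> pS Sx; case: (pselect (exists2 y, S y & x <> y)) => [[y Sy nxy]|h].
    by left; apply: (ax_I3 HM nxy).
  right; apply/seteqP; split=> [y Sy|y -> //].
  by apply: contrapT => nxy; apply: h; exists y => // e; apply: nxy.
have [p1 x1] : spray paths x S1 by apply: sub; do 3 left.
have [p2 x2] : spray paths x S2 by apply: sub; do 2 left; right.
have [p3 x3] : spray paths x S3 by apply: sub; left; right.
case: (QorX _ p1 x1) (QorX _ p2 x2) (QorX _ p3 x3) => e1 [] e2 [] e3; congruence.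
Qed.

Lemma unreachable_bounded {Q b x y} : paths Q -> ~ Q b ->
  Q x -> ~ unreachable paths Q b x -> unreachable paths Q b y ->
  exists z, [/\ betw x y z, Q z & ~ unreachable paths Q b z].
Proof.
move=> pQ nb Qx rx uy.
have [n [m [q [[_ _ ch] /andP[m0 mn] q0 qm [Qz rz]]]]] :=
  ax_I7 HM pQ nb (conj Qx rx) uy.
exists (q n); split=> //; rewrite -q0 -qm; apply: ch => //.
exact: leq_ltn_trans mn.
Qed.

Lemma reachable_path {Q b x} : Q x -> ~ unreachable paths Q b x ->
  exists R, [/\ paths R, R b & R x].
Proof. by move=> Qx r; apply: contrapT => h; apply: r. Qed.

Lemma path_reachable {Q R b x} : paths R -> R b -> R x ->
  ~ unreachable paths Q b x.
Proof. by move=> pR Rb Rx [_]; apply; exists R. Qed.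

(** No axiom states outright that a path has two events; I5, applied from an event off [Q], provides
    them. *)
Lemma second_event Q a : paths Q -> exists2 b, Q b & a <> b.
Proof.
move=> pQ; have [c nc] := event_off_path pQ.
have [y [z [nyz [Qy _] [Qz _]]]] := ax_I5 HM pQ nc.
case: (pselect (a = y)) => [e|]; last by exists y.
by exists z => //; rewrite e.
Qed.

Lemma crossing_path {Q a} : paths Q -> Q a ->
  exists R s, [/\ paths R, R a, R s & ~ Q s].
Proof.
move=> pQ Qa; have [c nc] := event_off_path pQ.
have nac : a <> c by move=> e; apply: nc; rewrite -e.
have [R [S [pR pS Ra Sc [e [Re Se]]]]] := ax_I2 HM nac.
case: (pselect (R = Q)) => [eRQ|nRQ]; last first.
  have [s Rs nas] := second_event _ a pR.
  by exists R, s; split=> // Qs; apply: nRQ; apply: (ax_I3 HM nas).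
(* Here I2 returned [Q] itself. If [S] meets [Q] at [e <> a], then [a] is off [S], and boundedness
   gives an event [z] of [S], beyond an unreachable one, that is joined to [a]; [z] is off [Q]
   because [S] meets [Q] only at [e]. *)
subst R; case: (pselect (e = a)) => [ea|nea].
  by exists S, c; split=> //; rewrite -ea.
have nSQ : S <> Q by move=> eSQ; apply: nc; rewrite -eSQ.
have nSa : ~ S a by move=> Sa; apply: nea; apply: (path_meet pS pQ).
have [y [_ [_ uy _]]] := ax_I5 HM pS nSa.
have [z [eyz Sz rz]] := unreachable_bounded pS nSa Se (path_reachable pQ Qa Re) uy.
have [T [pT Ta Tz]] := reachable_path Sz rz.
exists T, z; split=> // Qz; apply: (betw_neq13 eyz).
exact: (path_meet pS pQ).
Qed.

(* An event f of a crossing path through a that is unreachable from b makes b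
   unreachable from f on Q, so boundedness of Q(f,0) yields the event beyond b. *)
Lemma prolong {Q a b} : paths Q -> Q a -> Q b -> a <> b ->
  exists2 c, Q c & betw a b c.
Proof.
move=> pQ Qa Qb nab; have [R [s [pR Ra Rs nQs]]] := crossing_path pQ Qa.
have nRQ : R <> Q by move=> e; apply: nQs; rewrite -e.
have nRb : ~ R b by move=> Rb; apply: nab; apply: (path_meet pR pQ).
have [f [_ [_ [Rf uf] _]]] := ax_I5 HM pR nRb.
have nQf : ~ Q f by move=> Qf; apply: uf; exists Q.
have ub : unreachable paths Q f b.
  by split=> // -[T [pT Tf Tb]]; apply: uf; exists T.
have [c [abc Qc _]] := unreachable_bounded pQ nQf Qa (path_reachable pR Rf Ra) ub.
by exists c.
Qed.

(** * Paths cutting a triangle, and the exclusion of stars *)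

(** Pasch in the triangle [C' B A'], cut by [CA] at [B'] and through [C], puts an event of [CA]
    between [C'] and [B] on [AB]. It can only be [A], and [C' A B] contradicts [A C' B]. *)
Lemma triangle_no_middle {A B C A' B' C' AB BC CA T} :
  paths AB -> paths BC -> paths CA -> paths T ->
  AB <> BC -> BC <> CA -> CA <> AB ->
  AB A -> AB B -> BC B -> BC C -> CA C -> CA A ->
  BC A' -> CA B' -> AB C' -> T A' -> T B' -> T C' ->
  betw B A' C -> betw C B' A -> betw A C' B -> ~ betw A' B' C'.
Proof.
move=> pAB pBC pCA pT n1 n2 n3 ABA ABB BCB BCC CAC CAA BCA' CAB' ABC' TA' TB' TC'.
move=> BA'C CB'A AC'B A'B'C'.
have nABT : AB <> T.
  move=> e; apply: (betw_neq23 CB'A).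
  by apply: (path_meet pCA pAB) => //; rewrite e.
have nTBC : T <> BC.
  move=> e; apply: (betw_neq12 CB'A).
  by apply: (path_meet pCA pBC) => //; [move=> /esym | rewrite -e].
have [f [CAf ABf C'fB]] :=
  pasch pAB pT pBC pCA nABT n1 nTBC ABC' TC' ABB BCB TA' BCA'
    BA'C A'B'C' BCC TB' CAC CAB'.
have fA : f = A by apply: (path_meet pCA pAB).
by subst f; apply: (betw_not_swap C'fB).
Qed.

(** On [T] one of the three crossing events lies between the other two, and the hypotheses are
    invariant under cyclic relabelling of the triangle. *)
Lemma triangle_no_path {A B C A' B' C' AB BC CA T} :
  paths AB -> paths BC -> paths CA -> paths T ->
  AB <> BC -> BC <> CA -> CA <> AB ->
  AB A -> AB B -> BC B -> BC C -> CA C -> CA A ->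
  BC A' -> CA B' -> AB C' ->
  betw B A' C -> betw C B' A -> betw A C' B -> ~ [/\ T A', T B' & T C'].
Proof.
move=> pAB pBC pCA pT n1 n2 n3 ABA ABB BCB BCC CAC CAA BCA' CAB' ABC'.
move=> BA'C CB'A AC'B [TA' TB' TC'].
have nAB' : A' <> B'.
  move=> e; apply: (betw_neq23 BA'C).
  by apply: (path_meet pBC pCA) => //; rewrite e.
have nBC' : B' <> C'.
  move=> e; apply: (betw_neq23 CB'A).
  by apply: (path_meet pCA pAB) => //; rewrite e.
have nAC' : A' <> C'.
  move=> e; apply: (betw_neq12 BA'C).
  by apply: (path_meet pAB pBC) => //; rewrite e.
case: (ax_O5 HM pT TA' TB' TC' nAB' nAC' nBC').
- exact: (@triangle_no_middle A B C _ _ _ AB BC CA T).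
- exact: (@triangle_no_middle B C A _ _ _ BC CA AB T).
- exact: (@triangle_no_middle C A B _ _ _ CA AB BC T).
Qed.

(** An unreachable [c] is replaced by the event beyond it given by boundedness; O4 carries each
    [x b c] over to the new event, so a star centred at [b] stays a star. *)
Lemma reachable_beyond {Q s b c} : paths Q -> ~ Q s -> Q b -> Q c ->
  (exists R, [/\ paths R, R s & R b]) ->
  exists c', [/\ Q c', exists R, [/\ paths R, R s & R c']
    & forall x, betw x b c -> betw x b c'].
Proof.
move=> pQ nQs Qb Qc [R [pR Rs Rb]].
case: (pselect (unreachable paths Q s c)) => [uc|rc].
  have [c' [bcc' Qc' rc']] := unreachable_bounded pQ nQs Qb (path_reachable pR Rs Rb) uc.
  exists c'; split=> //; first exact: reachable_path rc'.
  by move=> x xbc; apply: (ax_O4 HM xbc).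
by exists c; split=> //; apply: reachable_path rc.
Qed.

(* Pick s off the path, joined to b.  By boundedness a, c, d can be moved
   outwards to be reachable from s, and some t with [s a t] is reachable from b;
   then the path bt crosses all three sides of the triangle s c d. *)
Lemma no_star {a b c d} : betw a b c -> betw a b d -> ~ betw c b d.
Proof.
move=> abc abd cbd.
have [Q [pQ Qa Qb Qc]] := ax_O1 HM abc.
have [Q' [pQ' Q'a Q'b Qd]] := ax_O1 HM abd.
have eQ : Q' = Q := ax_I3 HM (betw_neq12 abc) pQ' Q'a Q'b pQ Qa Qb.
subst Q' => {pQ' Q'a Q'b}.
have [R [s [pR Rb Rs nQs]]] := crossing_path pQ Qb.
have sb : exists R, [/\ paths R, R s & R b] by exists R.
have [a' [Qa' [SA [pSA SAs SAa]] ha]] := reachable_beyond pQ nQs Qb Qa sb.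
have [c' [Qc' [SC [pSC SCs SCc]] hc]] := reachable_beyond pQ nQs Qb Qc sb.
have [d' [Qd' [SD [pSD SDs SDd]] hd]] := reachable_beyond pQ nQs Qb Qd sb.
have {}abc := hc _ (betw_sym (ha _ (betw_sym abc))).
have {}abd := hd _ (betw_sym (ha _ (betw_sym abd))).
have {}cbd := hd _ (betw_sym (hc _ (betw_sym cbd))).
move=> {a c d Qa Qc Qd ha hc hd}.
have neqQ (S : set E) : S s -> S <> Q by move=> Ss e; apply: nQs; rewrite -e.
have neqS (S S' : set E) x y : paths S -> S s -> S x -> S' y -> Q x -> Q y -> x <> y -> S <> S'.
  move=> pS Ss Sx S'y Qx Qy nxy e; apply: nxy.
  by apply: (path_meet pS pQ) => //; [exact: neqQ | rewrite e].
have nSAb : ~ SA b.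
  by move=> SAb; apply: (betw_neq12 abc); apply: (path_meet pSA pQ) => //; apply: neqQ.
have nsa : s <> a' by move=> e; apply: nQs; rewrite e.
have [t0 SAt0 sat0] := prolong pSA SAs SAa nsa.
have ba : exists R, [/\ paths R, R b & R a'] by exists Q.
have [t [SAt [T [pT Tb Tt]] /(_ _ sat0) sat]] :=
  reachable_beyond pSA nSAb SAa SAt0 ba.
(* Pasch in the triangle [c' s a']: [s a' t] and [a' b c'] make [T] cross the side [SC]. The
   triangle [d' s a'] is treated likewise. *)
have [f [Tf SCf cfs]] : exists f, [/\ T f, SC f & betw c' f s].
  apply: (@pasch SC Q SA T c' s a' t b) => //.
  - exact: neqQ.
  - by apply: (neqS _ _ c' a') => //; apply/nesym/(betw_neq13 abc).
  - exact/nesym/neqQ.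
have [g [Tg SDg dgs]] : exists f, [/\ T f, SD f & betw d' f s].
  apply: (@pasch SD Q SA T d' s a' t b) => //.
  - exact: neqQ.
  - by apply: (neqS _ _ d' a') => //; apply/nesym/(betw_neq13 abd).
  - exact/nesym/neqQ.
apply: (@triangle_no_path c' d' s g f b Q SD SC T) => //.
- exact/nesym/neqQ.
- by apply: (neqS _ _ d' c') => //; apply/nesym/(betw_neq13 cbd).
- exact: neqQ.
- exact: betw_sym.
Qed.

(** * Linear order of a path *)

Lemma betw_same_path {Q a b c} : paths Q -> Q a -> Q c -> betw a b c -> Q b.
Proof.
move=> pQ Qa Qc abc; have [R [pR Ra Rb Rc]] := ax_O1 HM abc.
by rewrite (ax_I3 HM (betw_neq13 abc) pQ Qa Qc pR Ra Rc).
Qed.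

(** O4 refutes every unwanted order of the four events but one: [d b c] together with [a b c] and
    [a b d], which is a star. *)
Lemma betw_trans {a b c d} : betw a b c -> betw a c d -> betw a b d /\ betw b c d.
Proof.
move=> abc acd; have [Q [pQ Qa Qc Qd]] := ax_O1 HM acd.
have Qb := betw_same_path pQ Qa Qc abc.
have nab := betw_neq12 abc; have nbc := betw_neq23 abc.
have nad := betw_neq13 acd; have ncd := betw_neq23 acd.
have nbd : b <> d.
  by move=> e; subst d; apply: (betw_not_rot abc (betw_sym acd)).
have bcd_of : betw a b d -> betw b c d.
  move=> abd; case: (ax_O5 HM pQ Qb Qc Qd nbc nbd ncd) => // [cdb|dbc].
    by case: (betw_not_rot (ax_O4 HM acd cdb) (betw_sym abc)).
  by case: (no_star abc abd (betw_sym dbc)).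
suff abd : betw a b d by split=> //; apply: bcd_of.
case: (ax_O5 HM pQ Qa Qb Qd nab nad nbd) => // [bda|dab]; last first.
  by case: (betw_not_rot (ax_O4 HM dab abc) acd).
case: (ax_O5 HM pQ Qb Qc Qd nbc nbd ncd) => [bcd|cdb|dbc].
- exact: (ax_O4 HM abc bcd).
- by case: (betw_not_rot (ax_O4 HM acd cdb) (betw_sym abc)).
- by case: (betw_not_rot acd (betw_sym (ax_O4 HM (betw_sym bda) dbc))).
Qed.

Lemma betw_split {a x y c} : betw a x c -> betw a y c -> x <> y ->
  betw a x y \/ betw y x c.
Proof.
move=> axc ayc nxy; have [Q [pQ Qa Qx Qc]] := ax_O1 HM axc.
have Qy := betw_same_path pQ Qa Qc ayc.
case: (ax_O5 HM pQ Qa Qx Qy (betw_neq12 axc) (betw_neq12 ayc) nxy) => [|xya|yax].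
- by left.
- by right; case: (betw_trans (betw_sym xya) axc).
- by case: (betw_not_swap (ax_O4 HM (betw_sym yax) ayc)).
Qed.

(** * The order of the events of a finite chain *)

Section Chain.
Context {n : nat} {q : nat -> E} (Hq : finite_chain paths betw n q).

Lemma chain_mono i j k :
  (i < j)%N -> (j < k)%N -> (k <= n)%N -> betw (q i) (q j) (q k).
Proof.
case: Hq => _ _ ch ij jk kn; apply: ch => //.
apply: leq_trans kn; apply: leq_trans jk; rewrite ltnS.
exact: leq_ltn_trans ij.
Qed.

(** A third index ([n], 0 or 1) completes [i] and [j] to a betweenness, except when [n = 1], where
    distinctness comes from the [joins] clause. *)
Lemma chain_neq i j : (i < j)%N -> (j <= n)%N -> q i <> q j.
Proof.
move=> ij jn; case: (ltnP j n) => [jn'|nj].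
  exact: (betw_neq12 (chain_mono _ _ _ ij jn' (leqnn n))).
have ejn : j = n by apply/eqP; rewrite eqn_leq jn.
case: i ij => [j0|i ij]; last exact: (betw_neq23 (chain_mono 0 i.+1 _ isT ij jn)).
case: (ltnP 1 j) => [j1|j1]; first exact: (betw_neq13 (chain_mono 0 1 _ isT j1 jn)).
have ej : j = 1%N by apply/eqP; rewrite eqn_leq j1.
by case: Hq => _ /(_ (etrans (esym ejn) ej)) [Q []] *; rewrite ej.
Qed.

Lemma betw_chain_widen i j k l x :
  (i <= j)%N -> (j < k)%N -> (k <= l)%N -> (l <= n)%N ->
  betw (q j) x (q k) -> betw (q i) x (q l).
Proof.
move=> ij jk kl ln jxk.
have jxl : betw (q j) x (q l).
  case: (ltngtP k l) kl => // [kl _|<- //].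
  by case: (betw_trans jxk (chain_mono _ _ _ jk kl ln)).
case: (ltngtP i j) ij => // [ij _|-> //].
have ijl := chain_mono _ _ _ ij (leq_trans jk kl) ln.
by apply: betw_sym; case: (betw_trans (betw_sym jxl) (betw_sym ijl)).
Qed.

(** Widening the earlier segment gives [q_i x q_j], hence [x q_j q_(j+1)], which is incompatible
    with [q_j x q_(j+1)]. *)
Lemma chain_segments_disjoint i j x : (i < j)%N -> (j < n)%N ->
  betw (q i) x (q i.+1) -> ~ betw (q j) x (q j.+1).
Proof.
move=> ij jn ix jx.
have ixj := betw_chain_widen i i i.+1 j _ (leqnn i) (leqnn _) ij (ltnW jn) ix.
have [_ h] := betw_trans ixj (chain_mono _ _ _ ij (leqnn _) jn).
exact: (betw_not_swap h).
Qed.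

Lemma betw_chain_cover x : betw (q 0%N) x (q n) ->
  (forall i, (i <= n)%N -> x <> q i) ->
  exists2 i, (i < n)%N & betw (q i) x (q i.+1).
Proof.
move=> + nx; have : (n <= n)%N by [].
(* Induction on the index [m] of the right end, from [q_0 x q_m] with [m <= n]; the bound [i < n] on
   the index sought stays fixed. The case [m = 1] is separate, since splitting needs an interior
   chain event. *)
move: {1 3}n; elim=> [_ /betw_neq13 //|m IH mn h].
case: m IH mn h => [|m] IH mn h; first by exists 0%N.
have [h'|h'] := betw_split h (chain_mono 0 m.+1 _ isT (leqnn _) mn) (nx _ (ltnW mn)).
  exact: IH (ltnW mn) h'.
by exists m.+1.
Qed.

End Chain.

End PathOrder.

(** * Cutting a path at the events of a chain *)

Theorem mainTheorem11 (E : Type) (paths : set (set E))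
    (betw : E -> E -> E -> Prop) (HM : minkowski_axioms paths betw)
    (P : set E) (HP : paths P) (n : nat) (Hn : (2 <= n.+1)%N)
    (X : set E) (HXP : X `<=` P) (HXn : X #= `I_n.+1)
    (q : nat -> E) (Hq : finite_chain paths betw n q)
    (HX : X = [set q i | i in `I_n.+1]) :
  let a := q 0%N in
  let b := q n in
  let P1 := prolongation paths betw b a in
  let P2 := prolongation paths betw a b in
  let S := [set segment paths betw (q i) (q i.+1) | i in `I_n] in
  [/\ P = (\bigcup_(A in S) A) `|` P1 `|` P2 `|` X,
      forall A, S A -> is_segment paths betw A,
      forall A B, (S `|` [set P1; P2]) A -> (S `|` [set P1; P2]) B ->
        A <> B -> A `&` B = set0
    & [/\ P1 <> P2, ~ S P1 & ~ S P2]].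
Proof.
move=> a b P1 P2 S.
have n0 : (0 < n)%N by [].
have qP i : (i <= n)%N -> P (q i) by move=> lin; apply: HXP; rewrite HX; exists i.
have Pa : P a by apply: qP.
have Pb : P b by apply: qP.
have nab : a <> b by apply: (chain_neq HM Hq).
have nqS i : (i < n)%N -> q i <> q i.+1 by move=> lin; apply: (chain_neq HM Hq).
have jS i : (i < n)%N -> joins paths P (q i) (q i.+1).
  by move=> lin; split=> //; [exact: nqS | apply: qP; exact: ltnW | exact: qP].
(* By I3, the path hidden in [segment] and [prolongation] is always [P]. *)
have onP u v Q : P u -> P v -> joins paths Q u v -> Q = P.
  by move=> Pu Pv [pQ nuv Qu Qv]; apply: (ax_I3 HM nuv).
have segE i : (i < n)%N -> segment paths betw (q i) (q i.+1) `<=`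
    [set x | P x /\ betw (q i) x (q i.+1)].
  move=> lin x [Q jQ [Qx h]]; split=> //.
  by rewrite -(onP _ _ _ _ _ jQ) //; apply: qP => //; apply: ltnW.
have P1E x : P1 x -> P x /\ betw b a x.
  by move=> [Q jQ [Qx h]]; split=> //; rewrite -(onP _ _ _ _ _ jQ).
have P2E x : P2 x -> P x /\ betw a b x.
  by move=> [Q jQ [Qx h]]; split=> //; rewrite -(onP _ _ _ _ _ jQ).
have P1I x : P x -> betw b a x -> P1 x.
  by move=> Px h; exists P => //; split=> // /esym.
have P2I x : P x -> betw a b x -> P2 x by move=> Px h; exists P.
(* All segments lie between [a] and [b], so disjointness from the prolongations only concerns the
   order of [a], [b] and [x]. *)
have S_ab A x : S A -> A x -> betw a x b.
  move=> [i lin <-] /(segE _ lin) [_ h].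
  by apply: (betw_chain_widen HM Hq 0 i i.+1 n).
have d12 x : P1 x -> ~ P2 x.
  move=> /P1E [_ h1] /P2E [_ h2]; exact: (betw_not_swap HM h1).
have dS1 A x : S A -> A x -> ~ P1 x.
  move=> SA Ax /P1E [_ h]; have h' := S_ab _ _ SA Ax.
  exact: (betw_not_rot HM h h').
have dS2 A x : S A -> A x -> ~ P2 x.
  move=> SA Ax /P2E [_ h]; have h' := S_ab _ _ SA Ax.
  exact: (betw_not_rot HM h (betw_sym HM h')).
have dSS A B x : S A -> S B -> A <> B -> A x -> ~ B x.
  move=> [i lin <-] [j ljn <-] nAB /(segE _ lin) [_ hi] /(segE _ ljn) [_ hj].
  case: (ltngtP i j) => [ij|ji|eij]; last by rewrite eij in nAB.
    exact: (chain_segments_disjoint HM Hq _ _ _ ij ljn hi).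
  exact: (chain_segments_disjoint HM Hq _ _ _ ji lin hj).
(* Disjoint sets can coincide if empty; these witnesses turn disjointness into the inequalities
   required at the end. *)
have [x1 P1x1] : exists x, P1 x.
  by have [x Px h] := prolong HM HP Pb Pa (nesym nab); exists x; apply: P1I.
have [x2 P2x2] : exists x, P2 x.
  by have [x Px h] := prolong HM HP Pa Pb nab; exists x; apply: P2I.
split.
- apply/seteqP; split=> [x Px|x]; last first.
    by case=> [[[[A [i lin <-] /(segE _ lin) []]|/P1E []]|/P2E []]|/HXP].
  case: (pselect (X x)) => [|nXx]; [by right | left].
  have nxq i : (i <= n)%N -> x <> q i.
    by move=> lin e; apply: nXx; rewrite HX; exists i.
  have nax : a <> x by apply/nesym/nxq.
  have nbx : b <> x by apply/nesym/nxq.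
  (* In order: [x] lies beyond [b], between the ends, or beyond [a]. *)
  case: (ax_O5 HM HP Pa Pb Px nab nax nbx) => [h|h|h].
  + by right; apply: P2I.
  + left; left.
    have [i lin hi] := betw_chain_cover HM Hq x (betw_sym HM h) nxq.
    exists (segment paths betw (q i) (q i.+1)); first by exists i.
    by exists P; [exact: jS | split].
  + by left; right; apply: P1I => //; exact: (betw_sym HM).
- move=> A [i lin <-]; exists (q i), (q i.+1); split=> //.
  by exists P; apply: jS.
- move=> A B hA hB nAB; apply/seteqP; split=> // x [Ax Bx].
  case: hA hB Ax Bx nAB => [SA|[->|->]] [SB|[->|->]] Ax Bx nAB //=.
  + exact: (dSS A B x).
  + exact: (dS1 A x).
  + exact: (dS2 A x).
  + exact: (dS1 B x).
  + exact: (d12 x).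
  + exact: (dS2 B x).
  + exact: (d12 x).
- split=> [e|h|h].
  + by apply: (d12 x1) => //; rewrite -e.
  + exact: (dS1 _ _ h P1x1).
  + exact: (dS2 _ _ h P2x2).
Qed.
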